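(* Local finiteness is a local property: a locally integral ipo-semigroup $\mathbf A$ is locally finite if and only if all its integral components $\mathbf A_p$ ($p\in A^+$) are locally finite.
   Context: An ipo-semigroup is a structure $\mathbf A=(A,\le,\cdot,\sim,-)$ where $(A,\le)$ is a poset, $(A,\cdot)$ is a semigroup, and $\sim,-$ are order-reversing unary operations with $\sim{-}x=x=-{\sim}x$ and $xy\le z\iff y\cdot{\sim}z\le{\sim}x\iff -z\cdot x\le -y$ for all $x,y,z$. Its product is residuated, with residuals $z/y=-(y\cdot{\sim}z)$ and $x\backslash z={\sim}(-z\cdot x)$. An element $p$ is positive if $x\le px$ for all $x\in A$ (equivalently $x\le xp$ for all $x$); $A^+$ is the set of positive elements. $\mathbf A$ is locally integral if for all $x,y\in A$: $x\backslash x=x/x$ (this element is denoted $1_x$), $1_x\cdot x=x$, $y\le 1_xy$, $x\le 1_x$, and $x\backslash 1_x=1_x$. For $p\in A^+$, $A_p=\{y\in A:1_y=1_p\}$; these sets partition $A$, each is closed under $\cdot,\sim,-$ and contains $1_p=p$, and the integral component $\mathbf A_p=(A_p,\le,\cdot,1_p,\sim,-)$ carries the restricted relation and operations. A structure is locally finite if every subalgebra (subset closed under the operations $\cdot,\sim,-$, and containing the constant $1_p$ in the case of $\mathbf A_p$) generated by a finite set is finite. *)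

(* Defs.v *)
From HB Require Import structures.
From mathcomp Require Import all_boot all_order.
From mathcomp Require Import boolp classical_sets functions cardinality.

Set Implicit Arguments.
Unset Strict Implicit.
Unset Printing Implicit Defensive.

Import Order.TTheory.

Local Open Scope classical_set_scope.
Local Open Scope group_scope.
Local Open Scope order_scope.

(* Involutive partially ordered semigroups: [tneg x] is ∼x, [mneg x] is −x. *)
HB.mixin Record isIpoSemigroup (d : Order.disp_t) A
    of Order.POrder d A & Semigroup A := {
  tneg : A -> A;
  mneg : A -> A;
  tneg_anti : forall x y : A, x <= y -> tneg y <= tneg x;
  mneg_anti : forall x y : A, x <= y -> mneg y <= mneg x;
  mnegK : cancel mneg tneg;
  tnegK : cancel tneg mneg;
  mul_le_tneg : forall x y z : A, (x * y <= z) = (y * tneg z <= tneg x);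
  mul_le_mneg : forall x y z : A, (x * y <= z) = (mneg z * x <= mneg y)
}.

#[short(type="ipoSemigroupType")]
HB.structure Definition IpoSemigroup (d : Order.disp_t) :=
  {A of isIpoSemigroup d A & Order.POrder d A & Semigroup A}.

Section Definitions.

Context {d : Order.disp_t} {A : ipoSemigroupType d}.
Implicit Types (x y z p : A) (S X D : set A).

(* [over z y] is z / y and [under x z] is x \ z *)
Definition over z y : A := mneg (y * tneg z).
Definition under x z : A := tneg (mneg z * x).

Definition positive p : Prop := forall x, x <= p * x.

(* The element 1_x, equal to x / x as well in the locally integral case. *)
Definition unit_of x : A := under x x.

Definition integral_component p : set A := [set y | unit_of y = unit_of p].

Definition op_closed S : Prop :=
  [/\ forall x y, S x -> S y -> S (x * y),
      forall x, S x -> S (tneg x)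
    & forall x, S x -> S (mneg x)].

(* The signature of the component includes the constant 1_p, so that its
   subalgebras contain 1_p, whereas the empty set is a subalgebra of A. *)
Definition component_subalgebra p S : Prop :=
  [/\ S `<=` integral_component p, S (unit_of p) & op_closed S].

(* [sub] is the family of subalgebras of an algebra with carrier [D], and
   [smallest sub X] is the subalgebra generated by [X]. *)
Definition locally_finite_algebra D (sub : set (set A)) : Prop :=
  forall X, X `<=` D -> finite_set X -> finite_set (smallest sub X).

Definition component_locally_finite p : Prop :=
  locally_finite_algebra (integral_component p) (component_subalgebra p).

End Definitions.

Definition locally_integral (d : Order.disp_t) (A : ipoSemigroupType d) : Prop :=
  forall x y : A,
    [/\ under x x = over x x,
        unit_of x * x = x,
        y <= unit_of x * y,
        x <= unit_of x
      & under x (unit_of x) = unit_of x].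

Definition locally_finite (d : Order.disp_t) (A : ipoSemigroupType d) : Prop :=
  locally_finite_algebra [set: A] op_closed.

(* Each integral component is a subalgebra of itself, so the intersections
   [smallest (component_subalgebra p) X] with X in the component are over
   nonempty families. *)
Section ComponentClosed.

Context {d : Order.disp_t} {A : ipoSemigroupType d}.
Context (HA : locally_integral A).
Implicit Types x y z p : A.

Lemma le_under x y z : (x * y <= z) = (y <= under x z).
Proof.
rewrite mul_le_mneg /under; apply/idP/idP => [/tneg_anti|/mneg_anti].
  by rewrite mnegK.
by rewrite tnegK.
Qed.

Lemma le_over x y z : (x * y <= z) = (x <= over z y).
Proof.
rewrite mul_le_tneg /over; apply/idP/idP => [/mneg_anti|/tneg_anti].
  by rewrite tnegK.
by rewrite mnegK.
Qed.

Lemma ler_mul x y z : x <= y -> x * z <= y * z.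
Proof. by move=> xy; rewrite le_over (le_trans xy)// -le_over. Qed.

Lemma lel_mul x y z : x <= y -> z * x <= z * y.
Proof. by move=> xy; rewrite le_under (le_trans xy)// -le_under. Qed.

Lemma unit_mull x : unit_of x * x = x.
Proof. by have [] := HA x x. Qed.

Lemma le_unit_mull x y : y <= unit_of x * y.
Proof. by have [] := HA x y. Qed.

Lemma le_mul_unitr x y : y <= y * unit_of x.
Proof.
have : y * unit_of x <= y * unit_of x by [].
rewrite mul_le_tneg => /(le_trans (le_unit_mull x _)) /mneg_anti.
by rewrite !tnegK.
Qed.

Lemma unit_mulr x : x * unit_of x = x.
Proof. by apply/le_anti; rewrite le_mul_unitr le_under lexx. Qed.

Lemma unit_mul_unit x : unit_of x * unit_of x = unit_of x.
Proof.
apply/le_anti; rewrite le_mul_unitr andbT.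
by rewrite -[leRHS]/(under x x) -le_under mulgA !unit_mulr.
Qed.

Lemma unit_unit x : unit_of (unit_of x) = unit_of x.
Proof.
apply/le_anti/andP; split; last by have [] := HA (unit_of x) x.
by rewrite -{2}(unit_mull (unit_of x)) le_mul_unitr.
Qed.

Lemma mneg_unit_tneg x : mneg (unit_of (tneg x)) = tneg (unit_of x).
Proof.
have [eqx _ _ _ _] := HA x x.
by rewrite /unit_of eqx /over mnegK /under !tnegK.
Qed.

Lemma tneg2_unit x : unit_of (tneg x) = tneg (tneg (unit_of x)).
Proof. by rewrite -mneg_unit_tneg mnegK. Qed.

Lemma mneg2_unit x : unit_of (mneg x) = mneg (mneg (unit_of x)).
Proof. by rewrite -{2}[x]mnegK tneg2_unit !tnegK. Qed.

Lemma mneg2_unit_le x : mneg (mneg (unit_of x)) <= unit_of x.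
Proof.
set e := unit_of x; set f := mneg (mneg e).
have fE : f = unit_of (mneg e) by rewrite mneg2_unit unit_unit.
have : mneg e * f <= mneg e by rewrite fE unit_mulr.
rewrite mul_le_tneg mnegK; apply: le_trans.
exact: le_mul_unitr.
Qed.

Lemma tneg2_unit_le x : tneg (tneg (unit_of x)) <= unit_of x.
Proof.
set e := unit_of x; set g := tneg (tneg e).
have gE : g = unit_of (tneg e) by rewrite tneg2_unit unit_unit.
have : g * tneg e <= tneg e by rewrite gE unit_mull.
rewrite mul_le_mneg tnegK; apply: le_trans.
exact: le_unit_mull.
Qed.

Lemma unit_tneg x : unit_of (tneg x) = unit_of x.
Proof.
rewrite tneg2_unit; apply/le_anti; rewrite tneg2_unit_le /=.
by have /mneg_anti/tneg_anti/tneg_anti/tneg_anti := mneg2_unit_le x; rewrite !mnegK.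
Qed.

Lemma unit_mneg x : unit_of (mneg x) = unit_of x.
Proof. by rewrite -{2}[x]mnegK unit_tneg. Qed.

Lemma unit_mul x y : unit_of x = unit_of y -> unit_of (x * y) = unit_of x.
Proof.
move=> eqxy; set e := unit_of x; set h := unit_of (x * y).
have le_e z : unit_of z = e -> z <= e by move=> <-; have [] := HA z z.
have ge_e z : unit_of z = e -> mneg e <= z.
  move=> ze; rewrite -[z]tnegK; apply: mneg_anti.
  by apply: le_e; rewrite unit_tneg.
have absorb z : unit_of z = e -> mneg e * z = mneg e.
  move=> ze; have [_ _ _ _] := HA z z.
  by rewrite ze /under => /(congr1 mneg); rewrite tnegK.
have e0 : unit_of (mneg e) = e by rewrite unit_mneg unit_unit.
apply/le_anti/andP; split; last first.
  rewrite -[leRHS]/(under (x * y) (x * y)); have [-> _ _ _ _] := HA (x * y) x.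
  by rewrite -le_over mulgA unit_mull.
have xy_le : x * y <= e.
  apply: le_trans (ler_mul _ (le_e x erefl)) _.
  apply: le_trans (lel_mul _ (le_e y (esym eqxy))) _.
  by rewrite unit_mul_unit.
have le_xy : mneg e <= x * y.
  by rewrite -(absorb _ (esym eqxy)) ler_mul// ge_e.
have : mneg e * h <= e.
  by apply: le_trans xy_le; rewrite -[leRHS]unit_mulr ler_mul.
by rewrite le_under /under absorb // mnegK.
Qed.

Lemma component_subalgebra_self p :
  component_subalgebra p (integral_component p).
Proof.
split=> //; first exact: unit_unit.
split=> [x y xp yp|x xp|x xp]; rewrite /integral_component /=.
- by rewrite unit_mul xp.
- by rewrite unit_tneg.
- by rewrite unit_mneg.
Qed.

End ComponentClosed.

(* Main.v *)
(* A locally integral ipo-semigroup is glued from its components along the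
   central idempotents 1_x: one has 1_(x y) = 1_x 1_y, and with q = 1_x 1_y the
   elements q x and q y lie in A_q and satisfy x y = (q x) (q y).  Let G be
   generated by a finite set X.  The units of elements of G lie in the finite
   join-semilattice generated by the units of X.  By induction along it, every
   G ∩ A_q is finite: it is contained in the subalgebra of A_q generated by
   X ∩ A_q and the translates q (G ∩ A_p) with p < q. *)
Require Import Defs.
From mathcomp Require Import all_boot all_order.
From mathcomp Require Import classical_sets cardinality.

Set Implicit Arguments.
Unset Strict Implicit.
Unset Printing Implicit Defensive.

Import Order.TTheory.

Local Open Scope classical_set_scope.
Local Open Scope group_scope.
Local Open Scope order_scope.

(** Makes the number of entries of [t] below [q] a decreasing measure: for [p < q], the entry [p] is
    itself below [q] but not below [p]. *)
Lemma count_lt (T : eqType) (a b : pred T) (s : seq T) (x : T) :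
  subpred a b -> x \in s -> b x -> ~~ a x -> (count a s < count b s)%N.
Proof.
move=> ab xs bx nax; have := sub_count ab s; rewrite leq_eqVlt => /predU1P[|//].
elim: s xs => // y s IH; rewrite inE /= => /predU1P[<-|/IH{}IH].
  rewrite bx (negbTE nax) add0n => eqc.
  by have := sub_count ab s; rewrite eqc add1n ltnn.
case ay: (a y); first by rewrite (ab _ ay) => /addnI.
by case: (b y) => //; rewrite add0n add1n => eqc;
  have := sub_count ab s; rewrite eqc ltnn.
Qed.

(** * Generated subalgebras *)

Section Subalgebras.

Context {d : Order.disp_t} {A : ipoSemigroupType d}.
Implicit Types (p : A) (X : set A).

Lemma op_closed_smallest X : op_closed (smallest op_closed X).
Proof.
split=> [x y Gx Gy|x Gx|x Gx] M [cM XM]; have [mulM tM mM] := cM.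
- by apply: mulM; [apply: Gx | apply: Gy].
- by apply: tM; apply: Gx.
- by apply: mM; apply: Gx.
Qed.

Lemma component_subalgebra_smallest (hA : locally_integral A) p X :
  X `<=` integral_component p ->
  component_subalgebra p (smallest (component_subalgebra p) X).
Proof.
move=> Xp; split; first by apply: smallest_sub => //;
  exact: component_subalgebra_self.
  by move=> M [[]].
split=> [x y Gx Gy|x Gx|x Gx] M [cM XM]; have [_ _ [mulM tM mM]] := cM.
- by apply: mulM; [apply: Gx | apply: Gy].
- by apply: tM; apply: Gx.
- by apply: mM; apply: Gx.
Qed.

End Subalgebras.

(** * Positive elements, units and products across components *)

Section LocallyIntegral.

Context {d : Order.disp_t} {A : ipoSemigroupType d}.
Context (hA : locally_integral A).
Implicit Types (x y p q e : A) (X : set A).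

Lemma le_unit x : x <= unit_of x.
Proof. by have [] := hA x x. Qed.

Lemma le_unit_of_mull x y : (y * x <= x) = (y <= unit_of x).
Proof. by have [eqx _ _ _ _] := hA x x; rewrite /unit_of eqx le_over. Qed.

Lemma le_unit_of_mulr x y : (x * y <= x) = (y <= unit_of x).
Proof. exact: le_under. Qed.

Lemma positive_unit x : positive (unit_of x).
Proof. exact: le_unit_mull. Qed.

(** Positivity applied to 1_e gives 1_e <= e 1_e = e. Positive elements are thus exactly the units
    1_x, so facts about units transfer to them. *)
Lemma unit_positive e : positive e -> unit_of e = e.
Proof.
move=> e_pos; apply/le_anti; rewrite le_unit andbT.
by rewrite -[leRHS](unit_mulr hA) e_pos.
Qed.

Lemma positive_mulr e x : positive e -> x <= x * e.
Proof. by move=> /unit_positive <-; exact: le_mul_unitr. Qed.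

Lemma positive_idem e : positive e -> e * e = e.
Proof. by move=> /unit_positive <-; exact: unit_mul_unit. Qed.

Lemma positiveM p q : positive p -> positive q -> positive (p * q).
Proof.
by move=> p_pos q_pos x; rewrite -mulgA (le_trans (q_pos x)).
Qed.

(* As e (e x) = e x, e is below 1_(e x), so x e <= e x e <= e x. *)
Lemma positive_central e x : positive e -> e * x = x * e.
Proof.
move=> e_pos; have ee := positive_idem e_pos; apply/le_anti/andP; split.
  have : x * e * e <= x * e by rewrite -mulgA ee.
  rewrite le_unit_of_mulr -le_unit_of_mull; apply: le_trans.
  by apply: lel_mul; exact: positive_mulr.
have : e * (e * x) <= e * x by rewrite mulgA ee.
rewrite le_unit_of_mull -le_unit_of_mulr; apply: le_trans.
by apply: ler_mul; exact: e_pos.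
Qed.

(** The axiom x \ 1_x = 1_x at x = -e, where 1_x = e, reads ∼((-e)(-e)) = e. *)
Lemma mneg_positive_idem e : positive e -> mneg e * mneg e = mneg e.
Proof.
move=> /unit_positive eE.
have [_ _ _ _] := hA (mneg e) e.
by rewrite (unit_mneg hA) eE /under => /(congr1 mneg); rewrite tnegK.
Qed.

(* With p = 1_x and u = 1_(e x), the inequality -p <= x gives u (-p) <= e, and
   -e <= -p gives (-p) \ e <= e since -e is idempotent. *)
Lemma unit_mul_above e x :
  positive e -> unit_of x <= e -> unit_of (e * x) = e.
Proof.
move=> e_pos xe; have ee := positive_idem e_pos.
apply/le_anti/andP; split; last first.
  by rewrite -le_unit_of_mull mulgA ee.
set u := unit_of _; set z := mneg (unit_of x).
have ex_le : e * x <= e.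
  by rewrite -{2}ee lel_mul// (le_trans (le_unit x)).
have zx : z <= x.
  rewrite -[x]tnegK; apply: mneg_anti.
  by rewrite -(unit_tneg hA); exact: le_unit.
have : z * u <= e.
  have -> : z * u = u * z by rewrite -(positive_central z (positive_unit _)).
  apply: (le_trans _ ex_le); rewrite -[leRHS](unit_mull hA).
  by apply: lel_mul; apply: (le_trans zx); exact: e_pos.
rewrite le_under => /le_trans; apply.
rewrite /under -[leRHS]mnegK; apply: tneg_anti.
rewrite -{1}(mneg_positive_idem e_pos); apply: lel_mul.
exact: mneg_anti.
Qed.

(** By centrality q x = 1_y x and q y = 1_x y; in their product 1_x moves next to x and 1_y next to
    y, where they are absorbed. *)
Lemma mul_shift x y (q := unit_of x * unit_of y) :
  x * y = (q * x) * (q * y).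
Proof.
have cx z := positive_central z (positive_unit x).
have cy z := positive_central z (positive_unit y).
have -> : q * x = unit_of y * x.
  by rewrite /q cx -mulgA unit_mull.
have -> : q * y = unit_of x * y.
  by rewrite /q -mulgA unit_mull.
by rewrite cy -mulgA (mulgA (unit_of y)) -cx -mulgA unit_mull// mulgA unit_mulr.
Qed.

(** The element q = 1_x 1_y is above both units, so q x and q y lie in A_q, which is closed under
    products. *)
Lemma unit_ofM x y : unit_of (x * y) = unit_of x * unit_of y.
Proof.
have q_pos := positiveM (positive_unit x) (positive_unit y).
have qx := unit_mul_above q_pos (positive_mulr _ (positive_unit y)).
have qy := unit_mul_above q_pos (positive_unit x _).
by rewrite mul_shift unit_mul// qx.
Qed.

(** Positive elements are commuting idempotents, so a closed list [t] stays closed when [e] and all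
    multiples [e * q] with [q] in [t] are adjoined. *)
Lemma positive_closure (s : seq A) : (forall e, e \in s -> positive e) ->
  exists t : seq A, [/\ forall e, e \in t -> positive e, {subset s <= t}
    & forall p q, p \in t -> q \in t -> p * q \in t].
Proof.
elim: s => [|e s IH] pos_s; first by exists [::].
have e_pos : positive e by apply: pos_s; rewrite mem_head.
have [|t [pos_t st mul_t]] := IH.
  by move=> p ps; apply: pos_s; rewrite inE ps orbT.
have ee := positive_idem e_pos.
have inP p : reflect [\/ p = e, p \in t | exists2 q, q \in t & p = e * q]
    (p \in e :: t ++ [seq e * q | q <- t]).
  rewrite inE mem_cat; apply: (iffP or3P) => -[].
  - by move=> /eqP; apply: Or31.
  - by apply: Or32.
  - by move=> /mapP; apply: Or33.
  - by move=> ->; apply: Or31.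
  - by apply: Or32.
  - by move=> ?; apply: Or33; apply/mapP.
exists (e :: t ++ [seq e * q | q <- t]); split.
- move=> p /inP[->//|/pos_t//|[q /pos_t q_pos ->]]; exact: positiveM.
- by move=> p; rewrite inE => /predU1P[->|/st pt]; apply/inP;
    [apply: Or31 | apply: Or32].
- move=> p q /inP[->|pt|[p' pt ->]] /inP[->|qt|[q' qt ->]]; apply/inP.
  + by apply: Or31.
  + by apply: Or33; exists q.
  + by apply: Or33; exists q' => //; rewrite mulgA ee.
  + by apply: Or33; exists p => //; rewrite (positive_central p e_pos).
  + by apply: Or32; exact: mul_t.
  + apply: Or33; exists (p * q'); first exact: mul_t.
    by rewrite mulgA -(positive_central p e_pos) mulgA.
  + apply: Or33; exists p' => //.
    by rewrite -(positive_central (e * p') e_pos) mulgA ee.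
  + by apply: Or33; exists (p' * q); [exact: mul_t | rewrite mulgA].
  + apply: Or33; exists (p' * q'); first exact: mul_t.
    by rewrite mulgA -(positive_central (e * p') e_pos) !mulgA ee.
Qed.

(** * Finiteness of each component of a generated subalgebra *)

Lemma smallest_component_finite X (t : seq A) q :
  (forall e, e \in t -> positive e) ->
  (forall p r, p \in t -> r \in t -> p * r \in t) ->
  (forall x, X x -> unit_of x \in t) ->
  finite_set X ->
  (forall p, positive p -> component_locally_finite p) ->
  q \in t ->
  (forall p, p \in t -> p < q ->
     finite_set (smallest op_closed X `&` integral_component p)) ->
  finite_set (smallest op_closed X `&` integral_component q).
Proof.
set G := smallest op_closed X.
move=> pos_t mul_t Xt finX fin_comp qt IH.
have q_pos := pos_t _ qt; have qE := unit_positive q_pos.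
pose lower := [set p | (p \in t) && (p < q)].
pose Y := (X `&` integral_component q) `|`
  \bigcup_(p in lower) ((fun x => q * x) @` (G `&` integral_component p)).
have Yq : Y `<=` integral_component q.
  move=> x [[]//|[p /andP[pt pq] [y [Gy yp] <-]]].
  rewrite /integral_component /= qE unit_mul_above// yp unit_positive ?ltW//.
  exact: pos_t.
have finY : finite_set Y.
  rewrite finite_setU; split; first exact: finite_setIl.
  apply: bigcup_finite.
    apply: (@sub_finite_set _ _ [set` t]); last exact: finite_seq.
    by move=> p /andP[].
  by move=> p /andP[pt pq]; apply: finite_image; exact: IH.
have := fin_comp q q_pos Y Yq finY.
set H := smallest (component_subalgebra q) Y => finH.
have [Hq _ [mulH tH mH]] : component_subalgebra q H.
  exact: component_subalgebra_smallest.
have YH : Y `<=` H by exact: sub_gen_smallest.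
have [mulG tG mG] : op_closed G by exact: op_closed_smallest.
(* Membership in [H] is demanded only inside A_q, so that [T] can be closed under products of
   elements from other components. *)
pose T := [set x | [/\ G x, unit_of x \in t & unit_of x = q -> H x]].
have GT : G `<=` T; last first.
  apply: (sub_finite_set _ finH) => x [/GT[_ _ Hx]].
  by rewrite /integral_component /= qE.
apply: smallest_sub; last first.
  move=> x Xx; split; [exact: sub_gen_smallest | exact: Xt |].
  by move=> xq; apply: YH; left; split=> //; rewrite /integral_component /= qE.
(* If 1_x = q then q x is x itself; if 1_x < q it is one of the generators in [Y]. *)
have shift x : T x -> unit_of x <= q -> H (q * x).
  move=> [Gx xt Hx]; rewrite le_eqVlt => /predU1P[xq|xq].
    by rewrite -xq unit_mull//; exact: Hx.
  apply: YH; right; exists (unit_of x); first by rewrite /lower /= xt.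
  by exists x => //; split=> //; rewrite /integral_component /= unit_unit.
split=> [x y Tx Ty|x [Gx xt Hx]|x [Gx xt Hx]].
- have [Gx xt _] := Tx; have [Gy yt _] := Ty.
  split; [exact: mulG | by rewrite unit_ofM mul_t |].
  (* A product lying in A_q has both factors' units below q, so [shift] applies to each factor. *)
  rewrite unit_ofM => xyq; rewrite mul_shift xyq.
  apply: mulH; apply: shift => //; rewrite -xyq.
    by apply: positive_mulr; exact: positive_unit.
  exact: positive_unit.
- split; [exact: tG | by rewrite unit_tneg |].
  by rewrite unit_tneg// => /Hx; exact: tH.
- split; [exact: mG | by rewrite unit_mneg |].
  by rewrite unit_mneg// => /Hx; exact: mH.
Qed.

Lemma unit_of_smallest X (t : seq A) :
  (forall p q, p \in t -> q \in t -> p * q \in t) ->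
  (forall x, X x -> unit_of x \in t) ->
  forall x, smallest op_closed X x -> unit_of x \in t.
Proof.
move=> mul_t Xt; apply: smallest_sub => //.
split=> [x y /= xt yt|x /=|x /=]; first by rewrite unit_ofM mul_t.
  by rewrite unit_tneg.
by rewrite unit_mneg.
Qed.

(** * The two implications *)

Lemma locally_finite_component p :
  locally_finite A -> component_locally_finite p.
Proof.
move=> finA X Xp finX.
have [_ up [mulp tp mp]] := component_subalgebra_self hA p.
(* The constant 1_p becomes a generator, since subalgebras of A need not contain it. *)
pose Y := X `|` [set unit_of p].
have : finite_set (smallest op_closed Y).
  by apply: finA => //; rewrite finite_setU; split.
apply: sub_finite_set.
have [mulG tG mG] := op_closed_smallest Y.
have YG : Y `<=` smallest op_closed Y by exact: sub_gen_smallest.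
suff : smallest (component_subalgebra p) X
    `<=` smallest op_closed Y `&` integral_component p by move=> sub x /sub[].
apply: smallest_sub; last by move=> x Xx; split; [apply: YG; left | exact: Xp].
split; [by move=> x [] | by split=> //; apply: YG; right |].
split=> [x y [Gx xp] [Gy yp]|x [Gx xp]|x [Gx xp]].
- by split; [exact: mulG | exact: mulp].
- by split; [exact: tG | exact: tp].
- by split; [exact: mG | exact: mp].
Qed.

Lemma component_locally_finite_locally_finite :
  (forall p, positive p -> component_locally_finite p) -> locally_finite A.
Proof.
move=> fin_comp X _ finX.
have /finite_seqP[s sE] := finX.
have [|t [pos_t st mul_t]] := @positive_closure [seq unit_of x | x <- s].
  by move=> e /mapP[x _ ->]; exact: positive_unit.
have Xt x : X x -> unit_of x \in t.
  by rewrite sE => xs; apply: st; exact: map_f.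
have fin_t q : q \in t ->
    finite_set (smallest op_closed X `&` integral_component q).
  (* Strong induction on the number of entries of [t] strictly below [q]. *)
  have [n] := ubnP (count (fun p => p < q) t).
  elim: n q => // n IH q; rewrite ltnS => qn qt.
  apply: (smallest_component_finite pos_t mul_t Xt) => // p pt pq.
  apply: IH => //; apply: leq_trans qn.
  apply: (count_lt _ pt) => //; last by rewrite ltxx.
  by move=> r /= /lt_trans; apply.
(* Every generated element has its unit in [t], so finitely many finite slices cover the
   subalgebra. *)
apply: (@sub_finite_set _ _
  (\bigcup_(q in [set` t]) (smallest op_closed X `&` integral_component q))).
  move=> x Gx; exists (unit_of x); first exact: (unit_of_smallest mul_t Xt).
  by split=> //; rewrite /integral_component /= unit_unit.
by apply: bigcup_finite => //; exact: finite_seq.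
Qed.

End LocallyIntegral.

Theorem corollary3p20 (d : Order.disp_t) (A : ipoSemigroupType d)
    (hA : locally_integral A) :
  locally_finite A <->
  (forall p : A, positive p -> component_locally_finite p).
Proof.
split=> [finA p _|]; first exact: locally_finite_component.
exact: component_locally_finite_locally_finite.
Qed.
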